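(* Let $A\in\mathbb{C}^{m\times n}$, $B\in\mathbb{C}^{m}_{\mathrm H}$, $T_1\in\mathbb{C}^{p_1\times m}$ and $T_2\in\mathbb{C}^{p_2\times m}$, and assume that $AXA^*=B$ has a Hermitian solution. Put $$\mathcal{S}=\{X\in\mathbb{C}^{n}_{\mathrm H}\mid AXA^*=B\},$$ $$\mathcal{T}=\{(X_1+X_2)/2\mid T_1AX_1A^*T_1^*=T_1BT_1^*,\ T_2AX_2A^*T_2^*=T_2BT_2^*,\ X_1,X_2\in\mathbb{C}^{n}_{\mathrm H}\}.$$ Then: (a) $\mathcal{S}\subseteq\mathcal{T}$ always holds. (b) $\mathcal{S}=\mathcal{T}$ if and only if $$r\begin{bmatrix} T_1A \\ T_2A \end{bmatrix}=r(T_1A)+r(T_2A)-r(A).$$ (c) In particular, if $r(T_1A)=r(T_2A)=r(A)$, then $\mathcal{S}=\mathcal{T}$.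
   Context: $\mathbb{C}^{k}_{\mathrm H}$ is the set of $k\times k$ complex Hermitian matrices. $A^*$ and $r(A)$ denote the conjugate transpose and rank of $A$. *)

(* Defs.v *)
From mathcomp Require Import all_boot all_order all_algebra.
From mathcomp Require Import sesquilinear spectral complex.
From mathcomp Require Import classical_sets reals.

Set Implicit Arguments.
Unset Strict Implicit.
Unset Printing Implicit Defensive.

Import GRing.Theory Num.Theory.
Local Open Scope classical_set_scope.
Local Open Scope ring_scope.
Local Open Scope sesquilinear_scope.

Definition herm_sol (R : realType) (m n : nat)
    (A : 'M[R[i]]_(m, n)) (B : 'M[R[i]]_m) : set 'M[R[i]]_n :=
  [set X | X \is hermsymmx /\ A *m X *m A ^t* = B].

Definition avg_herm_sol (R : realType) (m n p1 p2 : nat)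
    (A : 'M[R[i]]_(m, n)) (B : 'M[R[i]]_m)
    (T1 : 'M[R[i]]_(p1, m)) (T2 : 'M[R[i]]_(p2, m)) : set 'M[R[i]]_n :=
  [set X | exists X1 X2 : 'M[R[i]]_n,
    [/\ X1 \is hermsymmx, X2 \is hermsymmx,
        T1 *m A *m X1 *m A ^t* *m T1 ^t* = T1 *m B *m T1 ^t*,
        T2 *m A *m X2 *m A ^t* *m T2 ^t* = T2 *m B *m T2 ^t*
      & X = 2^-1 *: (X1 + X2)]].

(* Main.v *)
Require Import Defs.
From mathcomp Require Import all_boot all_order all_algebra.
From mathcomp Require Import sesquilinear spectral complex.
From mathcomp Require Import classical_sets reals.
From mathcomp Require Import zify.

Import GRing.Theory Num.Theory.
Local Open Scope classical_set_scope.
Local Open Scope ring_scope.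

(** The set of averages is compared with the solution set through the kernels
    of [T1 *m A], [T2 *m A] and [A].

    Write [M] for either [T1 *m A] or [T2 *m A]; its row space lies in that of
    [A], with equality exactly when the ranks agree. If the row spaces agree,
    then [A = D *m M] for some [D], so the transformed equation, multiplied by
    [D] and its adjoint, gives back the original one: both summands of an
    average are then genuine solutions, and so is their average. Conversely,
    if every average is a solution, perturb a fixed solution [X0] on one side
    only, by [H = V V^*] where the columns of [V] span the kernel of [M]. The
    perturbation is invisible to the transformed equation, so
    [A H A^* = (A V) (A V)^*] must vanish. A complex matrix whose product with
    its adjoint is zero is itself zero, hence [A] vanishes on the kernel of
    [M], that is, the row space of [A] lies in that of [M].

    Hence the two sets are equal iff [T1 *m A] and [T2 *m A] both have the rank
    of [A]. The single rank identity is equivalent to this pair of equalities: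
    the stacked matrix has rank at least that of each block, which under the
    identity makes each block have rank at least that of [A]; and when both
    blocks have the row space of [A], so does the stacked matrix. *)

Local Open Scope sesquilinear_scope.

Lemma trCmxM (C : numClosedFieldType) (m n p : nat)
    (A : 'M[C]_(m, n)) (B : 'M[C]_(n, p)) :
  (A *m B) ^t* = B ^t* *m A ^t*.
Proof. by rewrite trmx_mul map_mxM. Qed.

(** The diagonal of [P P^*] consists of the squared norms of the rows of [P]. *)
Lemma mulmx_trC_eq0 (C : numClosedFieldType) (m n : nat) (P : 'M[C]_(m, n)) :
  P *m P ^t* = 0 -> P = 0.
Proof.
move=> PP0; apply/matrixP => i j; rewrite mxE.
have := congr1 (fun Q : 'M_m => Q i i) PP0; rewrite !mxE => sum0.
have sumn : \sum_k `|P i k| ^+ 2 = 0.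
  by rewrite -[RHS]sum0; apply: eq_bigr => k _; rewrite !mxE normCK.
have /(_ j isT)/eqP := psumr_eq0P (fun k _ => exprn_ge0 2 (normr_ge0 (P i k))) sumn.
by rewrite sqrf_eq0 normr_eq0 => /eqP.
Qed.

Lemma hermsymmxE (C : numClosedFieldType) (n : nat) (X : 'M[C]_n) :
  (X \is hermsymmx) = (X == X ^t*).
Proof. by rewrite qualifE /= expr0 scale1r. Qed.

Lemma hermsymmxD (C : numClosedFieldType) (n : nat) (X Y : 'M[C]_n) :
  X \is hermsymmx -> Y \is hermsymmx -> X + Y \is hermsymmx.
Proof.
rewrite !hermsymmxE => /eqP hX /eqP hY.
by rewrite linearD /= map_mxD -hX -hY.
Qed.

Arguments hermsymmxD {C n X Y}.

Lemma hermsymmx_mul_trC (C : numClosedFieldType) (m n : nat)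
    (V : 'M[C]_(m, n)) : V *m V ^t* \is hermsymmx.
Proof. by rewrite hermsymmxE trCmxM trmxCK. Qed.

Lemma hermsymmx_half (C : numClosedFieldType) (n : nat) (X : 'M[C]_n) :
  X \is hermsymmx -> 2^-1 *: X \is hermsymmx.
Proof.
rewrite !hermsymmxE => /eqP hX.
by rewrite linearZ /= map_mxZ -hX fmorphV /= rmorph_nat.
Qed.

Lemma half_double (C : numClosedFieldType) (n : nat) (X : 'M[C]_n) :
  2^-1 *: (X + X) = X.
Proof. by rewrite -mulr2n -scaler_nat scalerA mulVf ?scale1r ?pnatr_eq0. Qed.

Lemma submx_mulr_rank (F : fieldType) (p m n : nat)
    (T : 'M[F]_(p, m)) (A : 'M[F]_(m, n)) :
  (A <= T *m A)%MS = (\rank (T *m A) == \rank A).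
Proof.
by rewrite (mxrank_leqif_eq (submxMl T A)) submxMl.
Qed.

Section TransformedEquation.

Variables (C : numClosedFieldType) (m n p : nat).
Variables (A : 'M[C]_(m, n)) (B : 'M[C]_m) (T : 'M[C]_(p, m)).

(** If [A = D (T A)], then [D] and its adjoint undo the action of [T] on any
    matrix of the form [A Y A^*]. The solution [X0] is there to show that [B]
    has this form. *)
Lemma transformed_solution (X0 X : 'M[C]_n) :
  (A <= T *m A)%MS -> A *m X0 *m A ^t* = B ->
  T *m A *m X *m A ^t* *m T ^t* = T *m B *m T ^t* ->
  A *m X *m A ^t* = B.
Proof.
move=> /submxP[D AE] X0B XB.
have factor Y : A *m Y *m A ^t* =
    D *m (T *m A *m Y *m A ^t* *m T ^t*) *m D ^t*.
  by rewrite {1 2}AE !trCmxM !mulmxA.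
by rewrite factor XB -[RHS]X0B factor -X0B !mulmxA.
Qed.

(** The hypothesis is used only for [H = V V^*], with [V] the cokernel matrix
    of [T *m A]: then [A H A^*] is [A V] times its adjoint, and [A V = 0] is
    the inclusion of row spaces. *)
Lemma submx_of_null_perturbation :
  (forall H : 'M[C]_n, H \is hermsymmx -> T *m A *m H = 0 ->
     A *m H *m A ^t* = 0) ->
  (A <= T *m A)%MS.
Proof.
move=> null; rewrite submxE; apply/eqP/mulmx_trC_eq0.
set V := cokermx _.
rewrite trCmxM mulmxA -(mulmxA A); apply: null.
  exact: hermsymmx_mul_trC.
by rewrite mulmxA mulmx_coker mul0mx.
Qed.

End TransformedEquation.

Arguments transformed_solution {C m n p A B T X0 X}.

Section Averages.

Variables (R : realType) (m n p1 p2 : nat).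
Variables (A : 'M[R[i]]_(m, n)) (B : 'M[R[i]]_m).
Variables (T1 : 'M[R[i]]_(p1, m)) (T2 : 'M[R[i]]_(p2, m)).

Lemma herm_sol_sub_avg : herm_sol A B `<=` avg_herm_sol A B T1 T2.
Proof.
move=> X [hX XB]; exists X, X.
by split=> //; rewrite -?XB ?half_double ?mulmxA.
Qed.

Lemma avg_herm_solC : avg_herm_sol A B T1 T2 `<=` avg_herm_sol A B T2 T1.
Proof.
by move=> X [X1 [X2 [h1 h2 e1 e2 ->]]]; exists X2, X1; rewrite addrC.
Qed.

Lemma avg_sub_herm_sol :
  (A <= T1 *m A)%MS -> (A <= T2 *m A)%MS ->
  (exists X, herm_sol A B X) ->
  avg_herm_sol A B T1 T2 `<=` herm_sol A B.
Proof.
move=> sA1 sA2 [X0 [_ X0B]] X [X1 [X2 [h1 h2 e1 e2 ->]]].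
split; first by apply/hermsymmx_half/hermsymmxD.
rewrite -scalemxAr -scalemxAl mulmxDr mulmxDl.
rewrite (transformed_solution sA1 X0B e1).
by rewrite (transformed_solution sA2 X0B e2) half_double.
Qed.

Lemma submx_of_avg_sub :
  (exists X, herm_sol A B X) ->
  avg_herm_sol A B T1 T2 `<=` herm_sol A B ->
  (A <= T1 *m A)%MS.
Proof.
move=> [X0 [hX0 X0B]] sub; apply: submx_of_null_perturbation => H hH H0.
have [|_] := sub (X0 + H).
  (* Doubling the perturbation on the first side absorbs the factor 1/2. *)
  exists (X0 + H + H), X0; split=> //.
  - exact: hermsymmxD (hermsymmxD hX0 hH) hH.
  - by rewrite !mulmxDr H0 !addr0 -X0B !mulmxA.
  - by rewrite -X0B !mulmxA.
  - by rewrite -[LHS]half_double -!addrA [H + X0]addrC.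
by rewrite mulmxDr mulmxDl X0B => /(canRL (addKr _)); rewrite addNr.
Qed.

End Averages.

Lemma rank_col_mx_eq (F : fieldType) (p1 p2 m n : nat)
    (A : 'M[F]_(m, n)) (T1 : 'M[F]_(p1, m)) (T2 : 'M[F]_(p2, m)) :
  (\rank (col_mx (T1 *m A) (T2 *m A)))%:Z
    = (\rank (T1 *m A))%:Z + (\rank (T2 *m A))%:Z - (\rank A)%:Z
  <-> \rank (T1 *m A) = \rank A /\ \rank (T2 *m A) = \rank A.
Proof.
have le1 : (\rank (T1 *m A) <= \rank A)%N by rewrite mxrankS ?submxMl.
have le2 : (\rank (T2 *m A) <= \rank A)%N by rewrite mxrankS ?submxMl.
have := submx_refl (col_mx (T1 *m A) (T2 *m A)).
rewrite col_mx_sub => /andP[/mxrankS ge1 /mxrankS ge2].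
have leA : (\rank (col_mx (T1 *m A) (T2 *m A)) <= \rank A)%N.
  by rewrite mxrankS // col_mx_sub !submxMl.
lia.
Qed.

Local Close Scope sesquilinear_scope.

(* The rank condition is an equation in int: subtraction in nat is truncated *)
Theorem theorem5p1 (R : realType) (m n p1 p2 : nat)
    (A : 'M[R[i]]_(m, n)) (B : 'M[R[i]]_m)
    (T1 : 'M[R[i]]_(p1, m)) (T2 : 'M[R[i]]_(p2, m))
    (hB : B \is hermsymmx)
    (hsol : exists X : 'M[R[i]]_n, herm_sol A B X) :
  [/\ herm_sol A B `<=` avg_herm_sol A B T1 T2,
      herm_sol A B = avg_herm_sol A B T1 T2 <->
        (\rank (col_mx (T1 *m A) (T2 *m A)))%:Z
          = (\rank (T1 *m A))%:Z + (\rank (T2 *m A))%:Z - (\rank A)%:Z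
    & \rank (T1 *m A) = \rank A -> \rank (T2 *m A) = \rank A ->
        herm_sol A B = avg_herm_sol A B T1 T2].
Proof.
have sub := @herm_sol_sub_avg R m n p1 p2 A B T1 T2.
have eq_of_rank : \rank (T1 *m A) = \rank A -> \rank (T2 *m A) = \rank A ->
    herm_sol A B = avg_herm_sol A B T1 T2.
  move=> /eqP; rewrite -submx_mulr_rank => sA1.
  move=> /eqP; rewrite -submx_mulr_rank => sA2.
  by apply/seteqP; split=> //; exact: avg_sub_herm_sol.
split=> //; rewrite rank_col_mx_eq; split=> [eqST|[]]; last exact: eq_of_rank.
split; apply/eqP; rewrite -submx_mulr_rank.
  by apply: (@submx_of_avg_sub R m n p1 p2 A B T1 T2) => //; rewrite -eqST.
apply: (@submx_of_avg_sub R m n p2 p1 A B T2 T1) => //; rewrite eqST.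
exact: avg_herm_solC.
Qed.
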